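(* Let $\mathcal{M}'': z(u,v)=f(u)\,l(v)+g(u)\,e_4$, $u\in I$, $v\in J$, be a meridian surface of type $\mathcal{M}''$ in $\mathbb{E}^4_2$ (so $l$ is a unit-speed curve on $\mathbb{H}^2_1(-1)\subset\mathbb{E}^3_1$, $f'^2+g'^2=1$, and $g'$ is nowhere zero). Then $\mathcal{M}''$ is minimal if and only if the curve $l$ has zero spherical curvature ($\kappa\equiv0$ on $J$) and the meridian curve $u\mapsto(f(u),g(u))$ is given on $I$ by $$f(u)=\pm\sqrt{u^2+2au+b},\qquad g(u)=\pm\sqrt{b-a^2}\,\ln\left|u+a+\sqrt{u^2+2au+b}\right|+C,$$ for some real constants $a,b,C$ with $b-a^2>0$ and some choice of the two (independent) signs.
   Context: $\mathbb{E}^4_2$ is $\mathbb{R}^4$ with the inner product $\langle x,y\rangle=x_1y_1+x_2y_2-x_3y_3-x_4y_4$ and standard basis $e_1,e_2,e_3,e_4$. Let $\mathbb{E}^3_1=\mathrm{span}\{e_1,e_2,e_3\}$ and $\mathbb{H}^2_1(-1)=\{V\in\mathbb{E}^3_1:\langle V,V\rangle=-1\}$ (curves are taken on the sheet parametrized by $\sinh w^1\cos w^2\,e_1+\sinh w^1\sin w^2\,e_2+\cosh w^1\,e_3$). Meridian surface of type $\mathcal{M}''$: let $I,J\subset\mathbb{R}$ be open intervals, $f,g:I\to\mathbb{R}$ smooth with $f$ nowhere zero, $f'^2+g'^2=1$ and $g'$ nowhere zero (equivalently $f'^2<1$), and $l:J\to\mathbb{H}^2_1(-1)$ a smooth curve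 with $\langle l',l'\rangle=1$. The surface is $z(u,v)=f(u)l(v)+g(u)e_4$. Its induced metric is Lorentzian, with orthonormal tangent frame $X=z_u$, $Y=z_v/f=l'$, $\langle X,X\rangle=-1$, $\langle Y,Y\rangle=1$. Spherical curvature: put $t=l'$ and let $n$ be a smooth vector field along $l$ (unique up to sign) such that $\{l,t,n\}$ is an orthonormal frame of $\mathbb{E}^3_1$ with $\langle l,l\rangle=-1$, $\langle t,t\rangle=\langle n,n\rangle=1$; then $\kappa(v)=\langle t'(v),n(v)\rangle$, so that $t'=\kappa n+l$, $n'=-\kappa t$. For a Lorentz surface with second fundamental form $h$, the mean curvature vector field is $H=\tfrac12\,\mathrm{tr}\,h=\tfrac12\left(h(E_1,E_1)-h(E_2,E_2)\right)$ for any local orthonormal tangent frame with $\langle E_1,E_1\rangle=1$, $\langle E_2,E_2\rangle=-1$. The surface is minimal if $H=0$ identically. *)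

(* Defs.v *)
From HB Require Import structures.
From mathcomp Require Import all_boot all_order all_algebra.
From mathcomp Require Import ring.
From mathcomp Require Import all_classical all_reals all_analysis.

Set Implicit Arguments.
Unset Strict Implicit.
Unset Printing Implicit Defensive.

Import Order.TTheory GRing.Theory Num.Theory.
Import numFieldNormedType.Exports.

Local Open Scope ring_scope.
Local Open Scope classical_set_scope.

Section Smooth.
Context {R : realType}.

Definition open_interval (D : set R) : Prop :=
  [/\ D !=set0, is_interval D & open D].

(* Functions on an open interval D are represented by total functions on R:
   as D is open, the iterated derivatives at the points of D only depend on
   the values taken on D. *)
Definition smooth_on {V : normedModType R} (D : set R) (f : R -> V) : Prop :=
  forall (n : nat) (x : R), D x -> derivable (derive1n n f) x 1.

Definition sinh (w : R) : R := (expR w - expR (- w)) / 2.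
Definition cosh (w : R) : R := (expR w + expR (- w)) / 2.

End Smooth.

Section PseudoEuclidean.
Context {R : realType}.
Implicit Types x y w : 'rV[R]_4.

(* Coordinates are numbered from 0: the textbook x_k is x 0 (k-1), and the
   textbook e_k is [std_vec (k-1)]. *)
Definition ip x y : R :=
  x 0 0 * y 0 0 + x 0 1 * y 0 1 - x 0 2 * y 0 2 - x 0 3 * y 0 3.

Definition std_vec (i : 'I_4) : 'rV[R]_4 := delta_mx 0 i.

Definition E31 : set 'rV[R]_4 :=
  [set x | exists a b c, x = a *: std_vec 0 + b *: std_vec 1 + c *: std_vec 2].

Definition H21 : set 'rV[R]_4 := [set x | E31 x /\ ip x x = -1].

Definition H21_sheet : set 'rV[R]_4 :=
  [set x | exists w1 w2 : R,
     x = (sinh w1 * cos w2) *: std_vec 0 + (sinh w1 * sin w2) *: std_vec 1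
         + cosh w1 *: std_vec 2].

End PseudoEuclidean.

Section Surface.
Context {R : realType}.
Variable z : R -> R -> 'rV[R]_4.
Implicit Types (xi eta : R * R) (w : 'rV[R]_4).

Definition pd_u (y : R -> R -> 'rV[R]_4) (u v : R) : 'rV[R]_4 :=
  derive1 (fun s => y s v) u.
Definition pd_v (y : R -> R -> 'rV[R]_4) (u v : R) : 'rV[R]_4 :=
  derive1 (fun s => y u s) v.

(* A tangent vector at z(u,v) is given by its components in (z_u, z_v). *)
Definition dz (u v : R) xi : 'rV[R]_4 :=
  xi.1 *: pd_u z u v + xi.2 *: pd_v z u v.

Definition gE (u v : R) : R := ip (pd_u z u v) (pd_u z u v).
Definition gF (u v : R) : R := ip (pd_u z u v) (pd_v z u v).
Definition gG (u v : R) : R := ip (pd_v z u v) (pd_v z u v).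
Definition gram (u v : R) : R := gE u v * gG u v - gF u v ^+ 2.

(* Orthogonal projection onto the tangent plane; its components in
   (z_u, z_v) solve the linear system whose matrix is the induced metric.
   Meaningful where the induced metric is nondegenerate. *)
Definition tangent_coord (u v : R) w : R * R :=
  ((gG u v * ip w (pd_u z u v) - gF u v * ip w (pd_v z u v)) / gram u v,
   (gE u v * ip w (pd_v z u v) - gF u v * ip w (pd_u z u v)) / gram u v).

Definition normal_part (u v : R) w : 'rV[R]_4 :=
  w - dz u v (tangent_coord u v w).

(* h(xi, eta) is the normal part of the flat derivative D_xi eta, both
   vectors being extended with constant components in (z_u, z_v). *)
Definition sff (u v : R) xi eta : 'rV[R]_4 :=
  normal_part u v
    ((xi.1 * eta.1) *: pd_u (pd_u z) u v + (xi.1 * eta.2) *: pd_u (pd_v z) u v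
   + (xi.2 * eta.1) *: pd_v (pd_u z) u v + (xi.2 * eta.2) *: pd_v (pd_v z) u v).

Definition orthonormal_tangent_frame (u v : R) xi eta : Prop :=
  [/\ ip (dz u v xi) (dz u v xi) = 1,
      ip (dz u v eta) (dz u v eta) = -1
    & ip (dz u v xi) (dz u v eta) = 0].

(* The first conjunct (the induced metric is Lorentzian at the point) keeps
   the second one from holding vacuously. *)
Definition is_mean_curvature (u v : R) (H : 'rV[R]_4) : Prop :=
  (exists xi eta, orthonormal_tangent_frame u v xi eta) /\
  (forall xi eta, orthonormal_tangent_frame u v xi eta ->
     H = 2^-1 *: (sff u v xi xi - sff u v eta eta)).

Definition minimal_on (I J : set R) : Prop :=
  forall u v, I u -> J v -> is_mean_curvature u v 0.

Lemma normal_part_orth u v w : gram u v != 0 ->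
  ip (normal_part u v w) (pd_u z u v) = 0 /\
  ip (normal_part u v w) (pd_v z u v) = 0.
Proof.
rewrite /normal_part /dz /tangent_coord /= => W0.
have ipB a b (x y t c : 'rV[R]_4) :
    ip (c - (a *: x + b *: y)) t = ip c t - (a * ip x t + b * ip y t).
  by rewrite /ip !mxE; ring.
have ipC (x y : 'rV[R]_4) : ip x y = ip y x by rewrite /ip; ring.
rewrite !ipB (ipC (pd_v z u v) (pd_u z u v)) -/(gE u v) -/(gF u v) -/(gG u v).
by move: W0; rewrite /gram => W0; split; field.
Qed.

End Surface.

Section Meridian.
Context {R : realType}.
Variables (I J : set R) (f g : R -> R) (l : R -> 'rV[R]_4).

Definition meridian_map (u v : R) : 'rV[R]_4 := f u *: l v + g u *: std_vec 3.

(* Type M'': the profile (f, g) has f'^2 + g'^2 = 1 and the directrix l is a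
   spacelike curve on H^2_1(-1). *)
Record meridian_surface2 : Prop := MeridianSurface2 {
  ms_I : open_interval I;
  ms_J : open_interval J;
  ms_f_smooth : smooth_on I f;
  ms_g_smooth : smooth_on I g;
  ms_f_neq0 : forall u, I u -> f u != 0;
  ms_arclength : forall u, I u -> derive1 f u ^+ 2 + derive1 g u ^+ 2 = 1;
  ms_dg_neq0 : forall u, I u -> derive1 g u != 0;
  ms_l_smooth : smooth_on J l;
  ms_l_H21 : forall v, J v -> H21 (l v) /\ H21_sheet (l v);
  ms_l_unit : forall v, J v -> ip (derive1 l v) (derive1 l v) = 1
}.

Definition adapted_normal (n : R -> 'rV[R]_4) : Prop :=
  smooth_on J n /\
  forall v, J v ->
    [/\ E31 (l v), E31 (derive1 l v) & E31 (n v)] /\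
    [/\ ip (l v) (l v) = -1, ip (derive1 l v) (derive1 l v) = 1
      & ip (n v) (n v) = 1] /\
    [/\ ip (l v) (derive1 l v) = 0, ip (l v) (n v) = 0
      & ip (derive1 l v) (n v) = 0].

(* A relation, since kappa is defined only up to the sign of n. *)
Definition is_spherical_curvature (kappa : R -> R) : Prop :=
  exists2 n : R -> 'rV[R]_4, adapted_normal n &
    forall v, J v -> kappa v = ip (derive1 (derive1 l) v) (n v).

End Meridian.

(* Main.v *)
(* At each point the tangent plane is spanned by the orthonormal pair z_u = f' l + g' e4
   and z_v / f = l', and H = 0 amounts there to the vanishing of the normal part of
   z_vv - f^2 z_uu, which is f (l'' - (f f'' + f'^2) l - (f g'' + f' g') e4).
   Pairing with l and e4 and using <l'', l> = -1, this splits into l'' = l and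
   f f'' + f'^2 = 1, the remaining equation f g'' + f' g' = 0 being a consequence.
   The equation l'' = l says that the curvature vanishes. The equation
   (f f')' = 1 integrates to f^2 = u^2 + 2 a u + b, while (g' f)' = 0 gives
   g' = c / f with c^2 = f^2 - (f f')^2 = b - a^2. *)

Require Import Defs.
From mathcomp Require Import all_boot all_order all_algebra.
From mathcomp Require Import ring lra.
From mathcomp Require Import all_classical all_reals all_analysis.

Set Implicit Arguments.
Unset Strict Implicit.
Unset Printing Implicit Defensive.

Import Order.TTheory GRing.Theory Num.Theory.
Import numFieldNormedType.Exports.
Local Open Scope ring_scope.
Local Open Scope classical_set_scope.

(** * Derivatives on open sets, constancy and sign on intervals, matrix-valued maps *)

Section Calculus.
Context {R : realType}.
Implicit Types (D : set R) (x d : R).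

Lemma is_derive_ext {W : normedModType R} (F G : R -> W) x (d e : W) :
  F =1 G -> d = e -> is_derive x (1 : R) F d -> is_derive x (1 : R) G e.
Proof. by move=> /funext -> ->. Qed.

Lemma is_derive1_val {W : normedModType R} (F : R -> W) x (d : W) :
  is_derive x (1 : R) F d -> derive1 F x = d.
Proof. by move=> Fd; rewrite derive1E derive_val. Qed.

Lemma derivable_is_derive1 {W : normedModType R} (F : R -> W) x :
  derivable F x 1 -> is_derive x (1 : R) F (derive1 F x).
Proof. by move=> Fx; apply: DeriveDef; rewrite ?derive1E. Qed.

Lemma is_derive_eq_on {W : normedModType R} {D} (F G : R -> W) x (d : W) :
  open D -> D x -> {in D, F =1 G} ->
  is_derive x (1 : R) F d -> is_derive x (1 : R) G d.
Proof.
move=> oD Dx FG; apply: near_eq_is_derive.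
have : \forall y \near x, D y by exact: open_nbhs_nbhs.
by apply: filterS => y Dy; rewrite FG// inE.
Qed.

(** Differentiates an identity known only on an open set. Each constraint on [l], [f] and [g] yields
    its derived equation in this way. *)
Lemma derive_eq_on {W : normedModType R} {D} (F G : R -> W) x (d e : W) :
  open D -> D x -> {in D, F =1 G} ->
  is_derive x (1 : R) F d -> is_derive x (1 : R) G e -> d = e.
Proof.
move=> oD Dx FG /(is_derive_eq_on oD Dx FG) /is_derive1_val <-.
exact: is_derive1_val.
Qed.

Lemma interval_segment D a b x :
  is_interval D -> D a -> D b -> x \in `[a, b]%R -> D x.
Proof. by move=> iD Da Db; rewrite in_itv/=; exact: iD. Qed.

Lemma derivable_continuous_segment D (F : R -> R) a b :
  is_interval D -> (forall x, D x -> derivable F x 1) -> D a -> D b ->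
  {within `[a, b], continuous F}.
Proof.
move=> iD dF Da Db; apply: derivable_within_continuous => x xab; apply: dF.
exact: interval_segment Da Db xab.
Qed.

(** By the mean value theorem on the segment between the two points, which lies in [D]. *)
Lemma derive0_constant D (F : R -> R) : is_interval D ->
  (forall x, D x -> is_derive x (1 : R) F 0) ->
  forall x y, D x -> D y -> F x = F y.
Proof.
move=> iD dF; suff H x y : D x -> D y -> x <= y -> F x = F y.
  move=> x y Dx Dy; have [|/ltW] := leP x y; first exact: H.
  by move=> yx; apply/esym/H.
move=> Dx Dy xy.
have [||c _] := @MVT_segment R F (fun=> 0) x y xy.
- move=> z /subset_itv_oo_cc zxy; apply: dF; exact: interval_segment Dx Dy zxy.
- by apply: (@derivable_continuous_segment D) => // z /dF -[].
- by rewrite mul0r => /eqP; rewrite subr_eq0 => /eqP ->.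
Qed.

(** A change of sign would force a zero by the intermediate value theorem. For [f] it lets a single
    sign serve on the whole interval. *)
Lemma neq0_constant_sign D (F : R -> R) : is_interval D ->
  (forall x, D x -> derivable F x 1) -> (forall x, D x -> F x != 0) ->
  forall x y, D x -> D y -> (F x < 0) = (F y < 0).
Proof.
move=> iD dF F0; suff H x y : D x -> D y -> x <= y -> (F x < 0) = (F y < 0).
  move=> x y Dx Dy; have [|/ltW] := leP x y; first exact: H.
  by move=> yx; apply/esym/H.
move=> Dx Dy xy; apply/eqP/contraT => neq.
have [||c cxy Fc] := @IVT R F x y 0 xy.
- exact: (@derivable_continuous_segment D).
- move: neq; rewrite ge_min le_max.
  by case: ltP => [/ltW ->|_]; case: ltP => [/ltW ->|_] //=; rewrite ?orbT.
- by move: (F0 _ (interval_segment iD Dx Dy cxy)); rewrite Fc eqxx.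
Qed.

Lemma is_derive_entry {m n} (M : R -> 'M[R]_(m.+1, n.+1)) x (dM : 'M[R]_(m.+1, n.+1)) i j :
  is_derive x (1 : R) M dM -> is_derive x (1 : R) (fun t => M t i j) (dM i j).
Proof.
move=> [Mx Mv]; apply: DeriveDef; first exact: (derivable_mxP _ _ _).1 Mx i j.
by rewrite -Mv derive_mx// mxE.
Qed.

Lemma is_derive_entries {m n} (M : R -> 'M[R]_(m.+1, n.+1)) x (dM : 'M[R]_(m.+1, n.+1)) :
  (forall i j, is_derive x (1 : R) (fun t => M t i j) (dM i j)) ->
  is_derive x (1 : R) M dM.
Proof.
move=> dMij; have Mx : derivable M x 1 by apply/derivable_mxP => i j; have [] := dMij i j.
by apply: DeriveDef => //; rewrite derive_mx//; apply/matrixP => i j; rewrite mxE derive_val.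
Qed.

Lemma is_derive_mul (F G : R -> R) x F' G' :
  is_derive x (1 : R) F F' -> is_derive x (1 : R) G G' ->
  is_derive x (1 : R) (fun s => F s * G s) (F' * G x + F x * G').
Proof.
move=> dF dG; apply: is_derive_ext (is_deriveM dF dG) => //=.
by rewrite /GRing.scale/=; ring.
Qed.

Lemma is_derive_scale {m n} (F : R -> R) (M : R -> 'M[R]_(m.+1, n.+1)) x F'
    (M' : 'M[R]_(m.+1, n.+1)) :
  is_derive x (1 : R) F F' -> is_derive x (1 : R) M M' ->
  is_derive x (1 : R) (fun s => F s *: M s) (F' *: M x + F x *: M').
Proof.
move=> dF dM; apply: is_derive_entries => i j.
apply: is_derive_ext (is_derive_mul dF (is_derive_entry i j dM)).
  by move=> t; rewrite mxE.
by rewrite !mxE.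
Qed.

Lemma is_derive_ip (a b : R -> 'rV[R]_4) x (a' b' : 'rV[R]_4) :
  is_derive x (1 : R) a a' -> is_derive x (1 : R) b b' ->
  is_derive x (1 : R) (fun s => ip (a s) (b s)) (ip a' (b x) + ip (a x) b').
Proof.
move=> da db.
have E i := is_derive_mul (is_derive_entry 0 i da) (is_derive_entry 0 i db).
apply: is_derive_ext (is_deriveB (is_deriveB (is_deriveD (E 0) (E 1)) (E 2)) (E 3)) => //.
by rewrite /ip; ring.
Qed.

End Calculus.

(** * Linear algebra of the inner product *)

Section MinkowskiSpace.
Context {R : realType}.
Implicit Types (x y w : 'rV[R]_4) (k : R).

Lemma row4P x y :
  x 0 0 = y 0 0 -> x 0 1 = y 0 1 -> x 0 2 = y 0 2 -> x 0 3 = y 0 3 -> x = y.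
Proof.
move=> e0 e1 e2 e3; apply/rowP => -[[|[|[|[|//]]]] i4].
- by rewrite (_ : Ordinal i4 = 0)//; exact/val_inj.
- by rewrite (_ : Ordinal i4 = 1)//; exact/val_inj.
- by rewrite (_ : Ordinal i4 = 2)//; exact/val_inj.
- by rewrite (_ : Ordinal i4 = 3)//; exact/val_inj.
Qed.

Lemma E31P x : E31 x <-> x 0 3 = 0.
Proof.
split=> [[a [b [c ->]]]|x3]; first by rewrite !mxE/=; ring.
by exists (x 0 0), (x 0 1), (x 0 2); apply: row4P; rewrite !mxE/= ?x3; ring.
Qed.

Lemma ipC x y : ip x y = ip y x.
Proof. by rewrite /ip; ring. Qed.

Lemma ipDl x y w : ip (x + y) w = ip x w + ip y w.
Proof. by rewrite /ip !mxE; ring. Qed.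

Lemma ipZl k x w : ip (k *: x) w = k * ip x w.
Proof. by rewrite /ip !mxE; ring. Qed.

Lemma ipBl x y w : ip (x - y) w = ip x w - ip y w.
Proof. by rewrite /ip !mxE; ring. Qed.

Lemma ipDr x y w : ip w (x + y) = ip w x + ip w y.
Proof. by rewrite ipC ipDl !(ipC w). Qed.

Lemma ipZr k x w : ip w (k *: x) = k * ip w x.
Proof. by rewrite ipC ipZl (ipC w). Qed.

Lemma ip0l w : ip 0 w = 0.
Proof. by rewrite /ip !mxE; ring. Qed.

Lemma ip_std_vec3 : ip (std_vec 3) (std_vec 3) = -1 :> R.
Proof. by rewrite /ip !mxE/=; ring. Qed.

Lemma ip_E31_std_vec3 x : E31 x -> ip x (std_vec 3) = 0.
Proof. by move=> /E31P x3; rewrite /ip !mxE/= x3; ring. Qed.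

(** Lorentzian cross product of the first three coordinates. The last component is the negative of
    the Euclidean one, which makes [ip p (cross x y)] the usual determinant. *)
Definition cross x y : 'rV[R]_4 :=
  (x 0 1 * y 0 2 - x 0 2 * y 0 1) *: std_vec 0
  + (x 0 2 * y 0 0 - x 0 0 * y 0 2) *: std_vec 1
  - (x 0 0 * y 0 1 - x 0 1 * y 0 0) *: std_vec 2.

Lemma E31_cross x y : E31 (cross x y).
Proof. by apply/E31P; rewrite !mxE/=; ring. Qed.

Lemma ip_cross_left x y : ip x (cross x y) = 0.
Proof. by rewrite /ip !mxE/=; ring. Qed.

Lemma ip_cross_right x y : ip y (cross x y) = 0.
Proof. by rewrite /ip !mxE/=; ring. Qed.

(** Lagrange's identity, with the opposite sign to the Euclidean case because of the signature. *)
Lemma ip_cross x y : E31 x -> E31 y ->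
  ip (cross x y) (cross x y) = ip x y ^+ 2 - ip x x * ip y y.
Proof. by move=> /E31P x3 /E31P y3; rewrite /ip !mxE/= x3 y3; ring. Qed.

(* [ip x (cross y w)] is the determinant of (x, y, w); its square is minus the
   Gram determinant. *)
Lemma sqr_ip_cross x y w : E31 x -> E31 y -> E31 w ->
  ip x (cross y w) ^+ 2 =
  - (ip x x * (ip y y * ip w w - ip y w ^+ 2)
     - ip x y * (ip x y * ip w w - ip y w * ip x w)
     + ip x w * (ip x y * ip y w - ip y y * ip x w)).
Proof.
by move=> /E31P x3 /E31P y3 /E31P w3; rewrite /ip !mxE/= x3 y3 w3; ring.
Qed.

(** Cramer's rule: up to the determinant factor, the three cross products form the basis dual to
    [x], [y], [w]. *)
Lemma cramer_cross x y w p : E31 x -> E31 y -> E31 w -> E31 p ->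
  ip x (cross y w) *: p =
  ip p x *: cross y w + ip p y *: cross w x + ip p w *: cross x y.
Proof.
move=> /E31P x3 /E31P y3 /E31P w3 /E31P p3.
by apply: row4P; rewrite /ip !mxE/= ?x3 ?y3 ?w3 ?p3; ring.
Qed.

(** The Gram determinant of the frame is -1, so its determinant squares to 1 and is nonzero.
    Cramer's rule then expresses [p] through its three vanishing products. *)
Lemma orthonormal_frame_total x y w p : E31 x -> E31 y -> E31 w -> E31 p ->
  ip x x = -1 -> ip y y = 1 -> ip w w = 1 ->
  ip x y = 0 -> ip x w = 0 -> ip y w = 0 ->
  ip p x = 0 -> ip p y = 0 -> ip p w = 0 -> p = 0.
Proof.
move=> Ex Ey Ew Ep xx yy ww xy xw yw px py pw.
have d2 : ip x (cross y w) ^+ 2 = 1.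
  by rewrite sqr_ip_cross// xx yy ww xy xw yw; ring.
have d0 : ip x (cross y w) != 0.
  by apply: contra_eq_neq d2 => ->; rewrite expr0n eq_sym oner_neq0.
have := cramer_cross Ex Ey Ew Ep.
rewrite px py pw !scale0r !addr0 => /eqP.
by rewrite scaler_eq0 (negPf d0) => /eqP.
Qed.

Lemma cross_self x : cross x x = 0 :> 'rV[R]_4.
Proof. by apply: row4P; rewrite !mxE/=; ring. Qed.

Lemma is_derive_cross (a b : R -> 'rV[R]_4) (t : R) (a' b' : 'rV[R]_4) :
  is_derive t (1 : R) a a' -> is_derive t (1 : R) b b' ->
  is_derive t (1 : R) (fun s => cross (a s) (b s))
    (cross a' (b t) + cross (a t) b').
Proof.
move=> da db.
have E i j := is_derive_mul (is_derive_entry 0 i da) (is_derive_entry 0 j db).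
have M (F : R -> R) d w : is_derive t (1 : R) F d ->
    is_derive t (1 : R) (fun s => F s *: (w : 'rV[R]_4)) (d *: w).
  move=> dF; apply: is_derive_ext (is_derive_scale dF (is_derive_cst w t 1)) => //.
  by rewrite scaler0 addr0.
apply: is_derive_ext (is_deriveB (is_deriveD
  (M _ _ (std_vec 0) (is_deriveB (E 1 2) (E 2 1)))
  (M _ _ (std_vec 1) (is_deriveB (E 2 0) (E 0 2))))
  (M _ _ (std_vec 2) (is_deriveB (E 0 1) (E 1 0)))) => //.
by apply: row4P; rewrite !mxE/=; ring.
Qed.

End MinkowskiSpace.

(** * Mean curvature of a surface with orthogonal coordinates *)

(** For a 2 by 2 matrix, rows orthonormal for the Lorentzian form give orthonormal columns. This is
    what makes the trace of [sff] independent of the frame. *)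
Lemma pseudo_orthogonal_tr {R : realFieldType} (a b c d : R) :
  b ^+ 2 - a ^+ 2 = 1 -> d ^+ 2 - c ^+ 2 = -1 -> b * d = a * c ->
  [/\ a ^+ 2 = c ^+ 2 - 1, b ^+ 2 = d ^+ 2 + 1 & a * b = c * d].
Proof.
move=> e1 e2 e3.
have e4 : b ^+ 2 * d ^+ 2 = a ^+ 2 * c ^+ 2 by rewrite -!exprMn e3.
have b2 : b ^+ 2 = 1 + a ^+ 2 by lra.
have d2 : d ^+ 2 = c ^+ 2 - 1 by lra.
have a2 : a ^+ 2 = c ^+ 2 - 1 by move: e4; rewrite b2 d2; lra.
have b0 : b != 0.
  by apply: contra_eq_neq b2 => ->; rewrite expr0n/= lt_eqF// ltr_wpDr ?sqr_ge0.
split=> //; first by lra.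
apply: (mulfI b0); rewrite (_ : b * (c * d) = c * (b * d)); last by ring.
by rewrite e3 mulrCA [in RHS]mulrCA -!expr2; congr (_ * _); lra.
Qed.

Section MeanCurvature.
Context {R : realType}.
Variables (z : R -> R -> 'rV[R]_4) (u v r : R).
Hypotheses (gE1 : gE z u v = -1) (gF0 : gF z u v = 0) (gGr : gG z u v = r ^+ 2).
Hypothesis r0 : r != 0.

(* The identities below are first proved for arbitrary vectors: comparing [pd_u z]
   with [pd_v z] unfolds derivatives and makes [ring] and rewriting diverge. *)
Lemma normal_partE w : normal_part z u v w =
  w + ip w (pd_u z u v) *: pd_u z u v
    - (ip w (pd_v z u v) / r ^+ 2) *: pd_v z u v.
Proof.
have E (p q : R) (x y : 'rV[R]_4) :
    w - ((r ^+ 2 * p - 0 * q) / (-1 * r ^+ 2 - 0 ^+ 2) *: x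
         + (-1 * q - 0 * p) / (-1 * r ^+ 2 - 0 ^+ 2) *: y) =
    w + p *: x - (q / r ^+ 2) *: y.
  by apply: row4P; rewrite !mxE; field.
by rewrite /normal_part /dz /tangent_coord /gram /= gE1 gF0 gGr E.
Qed.

Lemma normal_partD w w' :
  normal_part z u v (w + w') = normal_part z u v w + normal_part z u v w'.
Proof.
have E (p p' q q' : R) (x y : 'rV[R]_4) :
    w + w' + (p + p') *: x - ((q + q') / r ^+ 2) *: y =
    w + p *: x - (q / r ^+ 2) *: y + (w' + p' *: x - (q' / r ^+ 2) *: y).
  by apply: row4P; rewrite !mxE; ring.
by rewrite !normal_partE !(ipDl w w') E.
Qed.

Lemma normal_partZ k w : normal_part z u v (k *: w) = k *: normal_part z u v w.
Proof.
have E (p q : R) (x y : 'rV[R]_4) :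
    k *: w + (k * p) *: x - (k * q / r ^+ 2) *: y =
    k *: (w + p *: x - (q / r ^+ 2) *: y).
  by apply: row4P; rewrite !mxE; ring.
by rewrite !normal_partE !(ipZl k w) E.
Qed.

Lemma orthonormal_tangent_frameE xi eta :
  orthonormal_tangent_frame z u v xi eta <->
  [/\ - xi.1 ^+ 2 + r ^+ 2 * xi.2 ^+ 2 = 1,
      - eta.1 ^+ 2 + r ^+ 2 * eta.2 ^+ 2 = -1
    & - xi.1 * eta.1 + r ^+ 2 * xi.2 * eta.2 = 0].
Proof.
have E p q : ip (dz z u v p) (dz z u v q) = - p.1 * q.1 + r ^+ 2 * p.2 * q.2.
  have H (x y : 'rV[R]_4) : ip x x = -1 -> ip x y = 0 -> ip y y = r ^+ 2 ->
      ip (p.1 *: x + p.2 *: y) (q.1 *: x + q.2 *: y) =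
      - p.1 * q.1 + r ^+ 2 * p.2 * q.2.
    move=> xx xy yy; rewrite !(ipDl, ipDr, ipZl, ipZr) (ipC y x) xx xy yy.
    by ring.
  exact: H gE1 gF0 gGr.
rewrite /orthonormal_tangent_frame !E.
by rewrite !(mulrA, expr2) !mulNr.
Qed.

(** Every orthonormal frame gives the same trace, namely the one computed from [z_v / r] and [z_u];
    multiplying it by [r ^+ 2] clears the denominator. *)
Lemma is_mean_curvature0P : is_mean_curvature z u v 0 <->
  normal_part z u v
    (pd_v (pd_v z) u v - r ^+ 2 *: pd_u (pd_u z) u v) = 0.
Proof.
have L a b c d (A B C D : 'rV[R]_4) :
    normal_part z u v (a *: A + b *: B + c *: C + d *: D) =
    a *: normal_part z u v A + b *: normal_part z u v B
    + c *: normal_part z u v C + d *: normal_part z u v D.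
  by rewrite !normal_partD !normal_partZ.
have LB k (A B : 'rV[R]_4) : normal_part z u v (A - k *: B) =
    normal_part z u v A - k *: normal_part z u v B.
  by rewrite -!scaleNr normal_partD normal_partZ.
have tr xi eta : orthonormal_tangent_frame z u v xi eta ->
    sff z u v xi xi - sff z u v eta eta =
    r ^- 2 *: normal_part z u v
                (pd_v (pd_v z) u v - r ^+ 2 *: pd_u (pd_u z) u v).
  case/orthonormal_tangent_frameE; move: xi eta => [a b] [c d] /= e1 e2 e3.
  have [a2 b2 ab] : [/\ a ^+ 2 = c ^+ 2 - 1, b ^+ 2 = d ^+ 2 + r ^- 2 & a * b = c * d].
    (* Since [z_v] has square norm [r ^+ 2], scaling the second components by [r] gives coordinates
       in an orthonormal basis. *)
    have [] := @pseudo_orthogonal_tr R a (r * b) c (r * d).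
    - by rewrite -e1; ring.
    - by rewrite -e2; ring.
    - by apply/eqP; rewrite -subr_eq0 -e3; apply/eqP; ring.
    move=> -> h1 h2; split=> //.
      by apply: (mulfI (expf_neq0 2 r0)); rewrite mulrDr divff ?expf_neq0// -!exprMn.
    by apply: (mulfI r0); rewrite mulrCA h2 mulrCA.
  rewrite /sff /= -!expr2 a2 b2 (mulrC b) (mulrC d) ab.
  (* As [a * b = c * d], the mixed terms of the two frame vectors coincide and cancel. *)
  have E (A B C D : 'rV[R]_4) :
      ((c ^+ 2 - 1) *: A + (c * d) *: B + (c * d) *: C + (d ^+ 2 + r ^- 2) *: D)
      - (c ^+ 2 *: A + (c * d) *: B + (c * d) *: C + d ^+ 2 *: D) =
      r ^- 2 *: (D - r ^+ 2 *: A).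
    by apply: row4P; rewrite !mxE; field.
  by rewrite !L LB E.
split=> [[[xi [eta fr]] H]|H].
  have /esym/eqP := H _ _ fr; rewrite tr//.
  by rewrite !scaler_eq0 !invr_eq0 expf_eq0 pnatr_eq0 (negPf r0) => /eqP.
split; last by move=> xi eta fr; rewrite tr// H !scaler0.
exists (0, r^-1), (1, 0); apply/orthonormal_tangent_frameE => /=.
by split; field.
Qed.

End MeanCurvature.

(** * First and second derivatives of smooth maps *)

Section SmoothMaps.
Context {R : realType} {W : normedModType R}.

Lemma smooth_on_is_derive1 (D : set R) (F : R -> W) x : smooth_on D F -> D x ->
  is_derive x (1 : R) F (derive1 F x).
Proof. by move=> sF Dx; apply: derivable_is_derive1; exact: (sF 0%N). Qed.

Lemma smooth_on_is_derive2 (D : set R) (F : R -> W) x : smooth_on D F -> D x ->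
  is_derive x (1 : R) (derive1 F) (derive1 (derive1 F) x).
Proof. by move=> sF Dx; apply: derivable_is_derive1; exact: (sF 1%N). Qed.

Lemma smooth_on_cst (D : set R) (w : W) : smooth_on D (fun=> w).
Proof.
have dn n : exists w' : W, derive1n n (fun=> w) = fun=> w'.
  elim: n => [|n [w' IH]]; first by exists w.
  exists 0; rewrite derive1nS IH; apply/funext => x; exact: derive1_cst.
by move=> n x _; have [w' ->] := dn n; exact: derivable_cst.
Qed.

End SmoothMaps.

(** * The directrix and its spherical curvature *)

Section Directrix.
Context {R : realType}.
Variables (J : set R) (l : R -> 'rV[R]_4).
Hypotheses (intJ : open_interval J) (smooth_l : smooth_on J l).
Hypothesis l_H21 : forall v, J v -> H21 (l v).
Hypothesis l_unit : forall v, J v -> ip (derive1 l v) (derive1 l v) = 1.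
Local Notation l' := (derive1 l).
Local Notation l'' := (derive1 (derive1 l)).

Let oJ : open J. Proof. by case: intJ. Qed.
Let dl v (Jv : J v) := smooth_on_is_derive1 smooth_l Jv.
Let d2l v (Jv : J v) := smooth_on_is_derive2 smooth_l Jv.

(** The subspace is cut out by the vanishing of the last coordinate, an equation that can be
    differentiated. *)
Lemma is_derive_E31 (c : R -> 'rV[R]_4) (dc : 'rV[R]_4) v : J v ->
  (forall v, J v -> E31 (c v)) -> is_derive v (1 : R) c dc -> E31 dc.
Proof.
move=> Jv Ec dcv; apply/E31P.
apply: derive_eq_on oJ Jv _ (is_derive_entry 0 3 dcv) (is_derive_cst (0 : R) v 1).
by move=> t; rewrite inE => /Ec /E31P.
Qed.

Lemma directrix_E31 v : J v -> E31 (l v).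
Proof. by move=> /l_H21[]. Qed.

Lemma directrix_E31_1 v : J v -> E31 (l' v).
Proof. by move=> Jv; apply: is_derive_E31 Jv directrix_E31 (dl Jv). Qed.

Lemma directrix_E31_2 v : J v -> E31 (l'' v).
Proof. by move=> Jv; apply: is_derive_E31 Jv directrix_E31_1 (d2l Jv). Qed.

Lemma ip_directrix v : J v -> ip (l v) (l v) = -1.
Proof. by move=> /l_H21[]. Qed.

Lemma ip_directrix01 v : J v -> ip (l v) (l' v) = 0.
Proof.
move=> Jv; have : ip (l' v) (l v) + ip (l v) (l' v) = 0.
  apply: derive_eq_on oJ Jv _ (is_derive_ip (dl Jv) (dl Jv)) (is_derive_cst (-1 : R) v 1).
  by move=> t; rewrite inE => /ip_directrix.
by rewrite ipC => /eqP; rewrite -mulr2n mulrn_eq0/= => /eqP.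
Qed.

Lemma ip_directrix12 v : J v -> ip (l' v) (l'' v) = 0.
Proof.
move=> Jv; have : ip (l'' v) (l' v) + ip (l' v) (l'' v) = 0.
  apply: derive_eq_on oJ Jv _ (is_derive_ip (d2l Jv) (d2l Jv)) (is_derive_cst (1 : R) v 1).
  by move=> t; rewrite inE => /l_unit.
by rewrite ipC => /eqP; rewrite -mulr2n mulrn_eq0/= => /eqP.
Qed.

(** Comes from differentiating [ip (l v) (l' v) = 0] and using the unit speed. *)
Lemma ip_directrix02 v : J v -> ip (l v) (l'' v) = -1.
Proof.
move=> Jv; have : ip (l' v) (l' v) + ip (l v) (l'' v) = 0.
  apply: derive_eq_on oJ Jv _ (is_derive_ip (dl Jv) (d2l Jv)) (is_derive_cst (0 : R) v 1).
  by move=> t; rewrite inE => /ip_directrix01.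
by rewrite l_unit// => /eqP; rewrite addrC addr_eq0 => /eqP.
Qed.

(** If the curvature vanishes, [l'' - l] is orthogonal to [l] and [l'] by the derived constraints
    and to [n] by assumption, hence zero. Conversely a normal field has to be exhibited, and the
    cross product of [l] and [l'] supplies it. *)
Lemma zero_spherical_curvatureP :
  is_spherical_curvature J l (fun=> 0) <-> forall v, J v -> l'' v = l v.
Proof.
split=> [[n [_ nP] kn] v Jv|ll].
  have [[El El' En] [[ll l'l' nn] [ll' ln l'n]]] := nP v Jv.
  apply/eqP; rewrite -subr_eq0; apply/eqP.
  have EB : E31 (l'' v - l v).
    have /E31P e2 := directrix_E31_2 Jv; have /E31P e0 := El.
    by apply/E31P; rewrite !mxE e2 e0 subrr.
  apply: (orthonormal_frame_total El El' En EB) => //.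
  - by rewrite ipBl ipC ip_directrix02// ll subrr.
  - by rewrite ipBl ipC ip_directrix12// ll' subrr.
  - by rewrite ipBl -kn// ln subrr.
have [[v0 Jv0] iJ _] := intJ.
(* Since l'' = l, the normal l x l' is constant. *)
have cst v : J v -> cross (l v) (l' v) = cross (l v0) (l' v0).
  move=> Jv; apply/rowP => j.
  apply: (@derive0_constant _ J (fun s => cross (l s) (l' s) 0 j)) => // t Jt.
  have := is_derive_entry 0 j (is_derive_cross (dl Jt) (d2l Jt)).
  by rewrite ll// cross_self add0r cross_self mxE.
(* Taking the value at [v0] as a constant field makes its smoothness immediate. *)
exists (fun=> cross (l v0) (l' v0)); last first.
  by move=> v Jv; rewrite ll// -(cst v Jv) ip_cross_left.
split=> [|v Jv]; first exact: smooth_on_cst.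
rewrite -(cst v Jv); have El := directrix_E31 Jv; have El' := directrix_E31_1 Jv.
split; first by split => //; exact: E31_cross.
split; split; rewrite ?ip_cross_left ?ip_cross_right ?ip_directrix ?ip_directrix01 ?l_unit//.
by rewrite ip_cross// ip_directrix01// ip_directrix// l_unit//; ring.
Qed.

End Directrix.

(** * The profile curve *)

Section Profile.
Context {R : realType}.
Variables (I : set R) (f g : R -> R).
Hypotheses (intI : open_interval I) (smooth_f : smooth_on I f)
  (smooth_g : smooth_on I g).
Hypothesis f_neq0 : forall u, I u -> f u != 0.
Hypothesis arclength : forall u, I u -> derive1 f u ^+ 2 + derive1 g u ^+ 2 = 1.
Hypothesis dg_neq0 : forall u, I u -> derive1 g u != 0.
Local Notation f' := (derive1 f).
Local Notation f'' := (derive1 (derive1 f)).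
Local Notation g' := (derive1 g).
Local Notation g'' := (derive1 (derive1 g)).

Let oI : open I. Proof. by case: intI. Qed.
Let iI : is_interval I. Proof. by case: intI. Qed.
Let df u (Iu : I u) := smooth_on_is_derive1 smooth_f Iu.
Let d2f u (Iu : I u) := smooth_on_is_derive2 smooth_f Iu.
Let dg u (Iu : I u) := smooth_on_is_derive1 smooth_g Iu.
Let d2g u (Iu : I u) := smooth_on_is_derive2 smooth_g Iu.

Lemma profile_acceleration u : I u -> f' u * f'' u + g' u * g'' u = 0.
Proof.
have half (a b c d : R) : b * a + a * b + (d * c + c * d) = 0 -> a * b + c * d = 0.
  by lra.
move=> Iu; apply: half.
apply: derive_eq_on oI Iu _ (is_deriveD (is_derive_mul (d2f Iu) (d2f Iu))
  (is_derive_mul (d2g Iu) (d2g Iu))) (is_derive_cst (1 : R) u 1).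
by move=> t; rewrite inE => /arclength; rewrite !expr2.
Qed.

(** The left side of the equation is [(f f')'], so [f f' - u] is a constant [a]. Then
    [(f^2)' = 2 (u + a)], and [b] is the second constant of integration. *)
Lemma profile_first_integral : (forall u, I u -> f u * f'' u + f' u ^+ 2 = 1) ->
  exists a b : R, forall u, I u ->
    f u * f' u = u + a /\ f u ^+ 2 = u ^+ 2 + 2 * a * u + b.
Proof.
move=> ode; have [[u0 Iu0] _ _] := intI.
pose P s := f s * f' s - s.
have cP u : I u -> P u = P u0.
  move=> Iu; apply: (@derive0_constant _ I P) => // t It.
  apply: is_derive_ext (is_deriveB (is_derive_mul (df It) (d2f It)) (is_derive_id t 1)) => //.
  by rewrite -(ode t It); ring.
have ff' u : I u -> f u * f' u = u + P u0.
  by move=> /cP; rewrite /P => H; lra.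
pose S s := f s * f s - s * s - 2 * P u0 * s.
have cS u : I u -> S u = S u0.
  move=> Iu; apply: (@derive0_constant _ I S) => // t It.
  apply: is_derive_ext (is_deriveB (is_deriveB (is_derive_mul (df It) (df It))
    (is_derive_mul (is_derive_id t 1) (is_derive_id t 1)))
    (is_derive_mul (is_derive_cst (2 * P u0) t 1) (is_derive_id t 1))) => //.
  by rewrite (mulrC (f' t)) (ff' t It) /=; ring.
exists (P u0), (S u0) => u Iu; split; first exact: ff'.
by rewrite -(cS u Iu) /S; ring.
Qed.

(** The derivative of [g' f] is [g'' f + g' f']. Multiplied by [g'] it becomes
    [f (f' f'' + g' g'') + f' (g'^2 - f f'')], where both brackets vanish; [g'] is then
    cancelled. *)
Lemma profile_second_integral : (forall u, I u -> f u * f'' u + f' u ^+ 2 = 1) ->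
  exists c : R, forall u, I u -> g' u * f u = c.
Proof.
have H (p p1 p2 q1 q2 : R) : p1 * p2 + q1 * q2 = 0 -> p1 ^+ 2 + q1 ^+ 2 = 1 ->
    p * p2 + p1 ^+ 2 = 1 -> q1 * (q2 * p + q1 * p1) = q1 * 0.
  move=> e1 e2 e3.
  transitivity (p * (p1 * p2 + q1 * q2) + p1 * (q1 ^+ 2 - p * p2)); first by ring.
  by rewrite e1 (_ : q1 ^+ 2 - p * p2 = 0); [ring | lra].
move=> ode; have [[u0 Iu0] _ _] := intI.
exists (g' u0 * f u0) => u Iu.
apply: (@derive0_constant _ I (fun s => g' s * f s)) => // t It.
apply: is_derive_ext (is_derive_mul (d2g It) (df It)) => //.
apply: (mulfI (dg_neq0 It)).
exact: H (profile_acceleration It) (arclength It) (ode t It).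
Qed.

Lemma sign_sqrt_sqr (x : R) : x = (-1) ^+ (x < 0)%R * Num.sqrt (x ^+ 2).
Proof.
by rewrite sqrtr_sqr; case: ltP => [/ltr0_norm ->|/ger0_norm ->]; ring.
Qed.

(** From the equation, the two first integrals determine [f] up to sign and [g'] as [c / f], which
    integrates to the logarithm. Conversely, [f^2] is the quadratic polynomial, and differentiating
    twice gives [f f' = u + a] and then the equation. *)
Lemma profileP : (forall u, I u -> f u * f'' u + f' u ^+ 2 = 1) <->
  exists a b C : R, 0 < b - a ^+ 2 /\
    exists s1 s2 : bool, forall u, I u ->
      f u = (-1) ^+ s1 * Num.sqrt (u ^+ 2 + 2 * a * u + b) /\
      g u = (-1) ^+ s2 * Num.sqrt (b - a ^+ 2)
              * ln `|u + a + Num.sqrt (u ^+ 2 + 2 * a * u + b)| + C.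
Proof.
split=> [ode|[a [b [C [_ [s1 [s2 fg]]]]]]]; last first.
  have ff u : I u -> f u * f u = u * u + 2 * a * u + b.
    move=> Iu; have [fu _] := fg u Iu; rewrite -!expr2.
    (* [Num.sqrt] is 0 on negative numbers, which would make [f] vanish; hence the radicand may be
       recovered by squaring. *)
    have Q0 : 0 <= u ^+ 2 + 2 * a * u + b.
      rewrite leNgt; apply/negP => /ltW Q0; have := f_neq0 Iu.
      by rewrite fu ler0_sqrtr// mulr0 eqxx.
    by rewrite fu exprMn sqrr_sign mul1r sqr_sqrtr.
  have ff' u : I u -> f u * f' u = u + a.
    move=> Iu; have : f' u * f u + f u * f' u = 1 * u + u * 1 + (0 * u + 2 * a * 1) + 0.
      apply: derive_eq_on oI Iu _ (is_derive_mul (df Iu) (df Iu))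
        (is_deriveD (is_deriveD
          (is_derive_mul (is_derive_id u 1) (is_derive_id u 1))
          (is_derive_mul (is_derive_cst (2 * a) u 1) (is_derive_id u 1)))
          (is_derive_cst b u 1)).
      by move=> t; rewrite inE => /ff.
    by lra.
  move=> u Iu; have : f' u * f' u + f u * f'' u = 1 + 0.
    apply: derive_eq_on oI Iu _ (is_derive_mul (df Iu) (d2f Iu))
      (is_deriveD (is_derive_id u 1) (is_derive_cst a u 1)).
    by move=> t; rewrite inE => /ff'.
  by rewrite expr2; lra.
have [[u0 Iu0] _ _] := intI.
have [a [b abP]] := profile_first_integral ode.
have [c cP] := profile_second_integral ode.
(* By arclength [c^2 = f^2 g'^2 = f^2 - (f f')^2], that is [u^2 + 2 a u + b - (u + a)^2]. *)
have c2 : c ^+ 2 = b - a ^+ 2.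
  have [e1 e2] := abP u0 Iu0; have e3 := arclength Iu0.
  have : c ^+ 2 = f u0 ^+ 2 - (f u0 * f' u0) ^+ 2.
    rewrite -(cP u0 Iu0) exprMn (_ : g' u0 ^+ 2 = 1 - f' u0 ^+ 2); last by lra.
    by ring.
  by rewrite e1 e2 => ->; ring.
have c0 : c != 0 by rewrite -(cP u0 Iu0) mulf_neq0 ?dg_neq0 ?f_neq0.
have ab0 : 0 < b - a ^+ 2 by rewrite -c2 exprn_even_gt0.
(* The square root is handled as s * f, so that only f gets differentiated. *)
pose s1 := f u0 < 0; pose s : R := (-1) ^+ s1.
have ss : s * s = 1 by rewrite -expr2 sqrr_sign.
have fE u : I u -> f u = s * Num.sqrt (u ^+ 2 + 2 * a * u + b).
  move=> Iu; have [_ <-] := abP u Iu; rewrite {1}[f u]sign_sqrt_sqr /s /s1.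
  by rewrite (neq0_constant_sign iI (smooth_f (n := 0%N)) f_neq0 Iu Iu0).
have sfE u : I u -> s * f u = Num.sqrt (u ^+ 2 + 2 * a * u + b).
  by move=> Iu; rewrite fE// mulrA ss mul1r.
(* The square of [s f] exceeds that of [u + a] by [b - a^2 > 0], so [s f > |u + a|]. This justifies
   differentiating [ln] and later removes the absolute value. *)
have arg_gt0 u : I u -> 0 < u + a + s * f u.
  move=> Iu; have y0 : 0 <= s * f u by rewrite sfE// sqrtr_ge0.
  have y2 : (s * f u) ^+ 2 = (u + a) ^+ 2 + (b - a ^+ 2).
    rewrite exprMn expr2 ss mul1r; have [_ ->] := abP u Iu; ring.
  by rewrite ltNge; apply/negP => neg; nra.
(* [G] is [g] minus the expected logarithm; its constant value will be [C]. The coefficient [c * s]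
   has square [b - a ^+ 2], and its sign gives [s2]. *)
pose G u := g u - c * s * ln (u + a + s * f u).
have dG u : I u -> is_derive u (1 : R) G 0.
  move=> Iu.
  have dL : is_derive u (1 : R) (fun t => t + a + s * f t) (1 + s * f' u).
    apply: is_derive_ext (is_deriveD (is_deriveD (is_derive_id u 1) (is_derive_cst a u 1))
      (is_derive_mul (is_derive_cst s u 1) (df Iu))) => //=.
    by ring.
  have dln := @is_derive1_comp R (@ln R) (fun t => t + a + s * f t) u _ _
    (is_derive1_ln (arg_gt0 u Iu)) dL.
  apply: is_derive_ext (is_deriveB (dg Iu) (is_derive_mul (is_derive_cst (c * s) u 1) dln)) => //=.
  have fu0 := f_neq0 Iu; have L0 : u + a + s * f u != 0 by rewrite gt_eqF ?arg_gt0.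
  have -> : g' u = c / f u by rewrite -(cP u Iu) mulfK.
  have -> : f' u = (u + a) / f u by have [<- _] := abP u Iu; rewrite mulrAC divff// mul1r.
  (* Because [s * s = 1], the argument of [ln] factors out of its own derivative and cancels. *)
  have -> : 1 + s * ((u + a) / f u) = s / f u * (u + a + s * f u).
    by rewrite mulrDr mulrACA ss; field.
  rewrite /GRing.scale/= -/s; transitivity (c / f u * (1 - s * s)).
    by field; rewrite fu0.
  by rewrite ss subrr mulr0.
exists a, b, (G u0); split => //; exists s1, (c * s < 0) => u Iu.
split; first exact: fE.
rewrite -sfE// ger0_norm ?ltW ?arg_gt0//.
have -> : b - a ^+ 2 = (c * s) ^+ 2 by rewrite exprMn c2 [s ^+ 2]ss mulr1.
rewrite -sign_sqrt_sqr (derive0_constant iI dG Iu0 Iu) /G.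
by rewrite addrC subrK.
Qed.

End Profile.

(** * Mean curvature of the meridian surface *)

Section MeridianMeanCurvature.
Context {R : realType}.
Variables (I J : set R) (f g : R -> R) (l : R -> 'rV[R]_4).
Hypothesis hM : meridian_surface2 I J f g l.
Local Notation z := (meridian_map f g l).

Let intI := ms_I hM.
Let intJ := ms_J hM.
Let oI : open I. Proof. by case: intI. Qed.
Let oJ : open J. Proof. by case: intJ. Qed.
Let l_H21 v (Jv : J v) : H21 (l v). Proof. by have [] := ms_l_H21 hM Jv. Qed.

Lemma is_derive_lincomb (p q : R -> R) (x y : 'rV[R]_4) u p' q' :
  is_derive u (1 : R) p p' -> is_derive u (1 : R) q q' ->
  is_derive u (1 : R) (fun s => p s *: x + q s *: y) (p' *: x + q' *: y).
Proof.
move=> dp dq; apply: is_derive_ext (is_deriveD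
  (is_derive_scale dp (is_derive_cst x u 1))
  (is_derive_scale dq (is_derive_cst y u 1))) => //.
by rewrite !scaler0 !addr0.
Qed.

(** Used with [y] the [e_4] term for [z_v], and with [y = 0] for [z_vv]. *)
Lemma is_derive_affine (c : R -> 'rV[R]_4) (c' y : 'rV[R]_4) k v :
  is_derive v (1 : R) c c' ->
  is_derive v (1 : R) (fun s => k *: c s + y) (k *: c').
Proof.
move=> dc; apply: is_derive_ext (is_deriveD
  (is_derive_scale (is_derive_cst k v 1) dc) (is_derive_cst y v 1)) => //.
by rewrite scale0r add0r addr0.
Qed.

Lemma meridian_pd_u u v : I u ->
  pd_u z u v = derive1 f u *: l v + derive1 g u *: std_vec 3.
Proof.
move=> Iu; apply: is_derive1_val; apply: is_derive_lincomb.
  exact: smooth_on_is_derive1 (ms_f_smooth hM) Iu.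
exact: smooth_on_is_derive1 (ms_g_smooth hM) Iu.
Qed.

Lemma meridian_pd_uu u v : I u -> pd_u (pd_u z) u v =
  derive1 (derive1 f) u *: l v + derive1 (derive1 g) u *: std_vec 3.
Proof.
move=> Iu; apply: is_derive1_val.
apply: is_derive_eq_on oI Iu _ (is_derive_lincomb _ _
  (smooth_on_is_derive2 (ms_f_smooth hM) Iu)
  (smooth_on_is_derive2 (ms_g_smooth hM) Iu)).
by move=> t; rewrite inE => It; rewrite meridian_pd_u.
Qed.

Lemma meridian_pd_v u v : J v -> pd_v z u v = f u *: derive1 l v.
Proof.
move=> Jv; apply: is_derive1_val; apply: is_derive_affine.
exact: smooth_on_is_derive1 (ms_l_smooth hM) Jv.
Qed.

Lemma meridian_pd_vv u v : J v ->
  pd_v (pd_v z) u v = f u *: derive1 (derive1 l) v.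
Proof.
move=> Jv; apply: is_derive1_val.
apply: is_derive_eq_on oJ Jv _ (is_derive_affine 0 (f u)
  (smooth_on_is_derive2 (ms_l_smooth hM) Jv)).
by move=> t; rewrite inE => Jt; rewrite meridian_pd_v// addr0.
Qed.

(** The coordinates are orthogonal with [r = f u], so the criterion reduces to the vanishing of one
    explicit vector in [l''], [l] and [e_4]. *)
Lemma meridian_mean_curvature0P u v : I u -> J v ->
  is_mean_curvature z u v 0 <->
  f u * derive1 (derive1 f) u + derive1 f u ^+ 2 = 1 /\
  derive1 (derive1 l) v = l v.
Proof.
move=> Iu Jv.
have sl := ms_l_smooth hM; have lu := ms_l_unit hM.
have El := directrix_E31 l_H21 Jv.
have El2 := directrix_E31_2 intJ sl l_H21 Jv.
have h3 := ip_E31_std_vec3 El.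
have h3' := ip_E31_std_vec3 (directrix_E31_1 intJ sl l_H21 Jv).
have h3'' := ip_E31_std_vec3 El2.
have h00 := ip_directrix l_H21 Jv.
have h01 := ip_directrix01 intJ sl l_H21 Jv.
have h11 := lu v Jv.
have h12 := ip_directrix12 intJ sl lu Jv.
have h02 := ip_directrix02 intJ sl l_H21 lu Jv.
have arc := ms_arclength hM Iu.
have acc := profile_acceleration intI (ms_f_smooth hM) (ms_g_smooth hM)
  (ms_arclength hM) Iu.
have f0 := ms_f_neq0 hM Iu; have g0 := ms_dg_neq0 hM Iu.
have zu := meridian_pd_u v Iu; have zv := meridian_pd_v u Jv.
have zuu := meridian_pd_uu v Iu; have zvv := meridian_pd_vv u Jv.
(* All derivatives are now abstracted to plain vectors and scalars, leaving pure algebra. *)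
move: (derive1 (derive1 l) v) (derive1 l v) (l v) zu zv zuu zvv El El2
  h3 h3' h3'' h00 h01 h11 h12 h02 => l2 l1 l0 zu zv zuu zvv El El2
  h3 h3' h3'' h00 h01 h11 h12 h02.
move: (derive1 (derive1 f) u) (derive1 (derive1 g) u) (derive1 f u) (derive1 g u)
  (f u) zu zv zuu zvv arc acc f0 g0 => f2 g2 f1 g1 r zu zv zuu zvv arc acc r0 g0.
have h33 := @ip_std_vec3 R.
have ip33 (x y : 'rV[R]_4) (a b c d : R) : ip x (std_vec 3) = 0 -> ip y (std_vec 3) = 0 ->
    ip (a *: x + b *: std_vec 3) (c *: y + d *: std_vec 3) = a * c * ip x y - b * d.
  move=> x3 y3; rewrite !(ipDl, ipDr, ipZl, ipZr) x3 (ipC (std_vec 3) y) y3 h33; ring.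
have gE1 : gE z u v = -1.
  by rewrite /gE zu ip33// h00; move: arc; rewrite !expr2; lra.
have gF0 : gF z u v = 0.
  by rewrite /gF zu zv !(ipDl, ipZr, ipZl) (ipC (std_vec 3)) h01 h3'; ring.
have gGr : gG z u v = r ^+ 2 by rewrite /gG zv ipZl ipZr h11; ring.
rewrite (is_mean_curvature0P gE1 gF0 gGr r0).
rewrite (normal_partE gE1 gF0 gGr r0) zu zv zuu zvv.
have -> : r *: l2 - r ^+ 2 *: (f2 *: l0 + g2 *: std_vec 3) =
    1 *: (r *: l2 - (r ^+ 2 * f2) *: l0) + (- (r ^+ 2 * g2)) *: std_vec 3.
  by rewrite scale1r scalerDr opprD addrA !scalerA scaleNr.
set w := 1 *: _ + _.
(* The second derivatives drop out because [f' f'' + g' g'' = 0]. *)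
have -> : ip w (f1 *: l0 + g1 *: std_vec 3) = - (r * f1).
  rewrite /w ip33 ?h3//; last by rewrite ipBl !ipZl h3 h3''; ring.
  rewrite ipBl !ipZl (ipC l2) h02 h00.
  transitivity (r ^+ 2 * (f1 * f2 + g1 * g2) - r * f1); first by ring.
  by rewrite acc; ring.
have -> : ip w (r *: l1) = 0.
  rewrite /w ipZr ipDl !ipZl ipBl !ipZl (ipC l2) h12 h01 (ipC (std_vec 3)) h3'.
  by ring.
have -> : w + - (r * f1) *: (f1 *: l0 + g1 *: std_vec 3)
    - (0 / r ^+ 2) *: (r *: l1) =
    r *: (l2 - (r * f2 + f1 ^+ 2) *: l0 - (r * g2 + f1 * g1) *: std_vec 3).
  by rewrite /w; apply: row4P; rewrite !mxE; ring.
split=> [/eqP|[e1 ->]].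
  rewrite scaler_eq0 (negPf r0)/= => /eqP eq0.
  (* Pairing with [l] isolates this coefficient, since [ip l'' l = ip l l = -1]. *)
  have e1 : r * f2 + f1 ^+ 2 = 1.
    have : ip (l2 - (r * f2 + f1 ^+ 2) *: l0 - (r * g2 + f1 * g1) *: std_vec 3) l0 = 0.
      by rewrite eq0 ip0l.
    rewrite !ipBl !ipZl (ipC l2) h02 h00 (ipC (std_vec 3)) h3 => H; lra.
  have e2 : r * g2 + f1 * g1 = 0.
    have : ip (l2 - (r * f2 + f1 ^+ 2) *: l0 - (r * g2 + f1 * g1) *: std_vec 3) (std_vec 3) = 0.
      by rewrite eq0 ip0l.
    rewrite !ipBl !ipZl h3'' h3 h33 => H; lra.
  split=> //; apply/eqP; rewrite -subr_eq0; apply/eqP.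
  by move: eq0; rewrite e1 e2 scale1r scale0r subr0.
(* Same device as for the constancy of [g' f]: multiply by [g'], regroup, and cancel. *)
have e2 : r * g2 + f1 * g1 = 0.
  apply: (mulfI g0); transitivity (r * (f1 * f2 + g1 * g2) + f1 * (g1 ^+ 2 - r * f2)).
    by ring.
  rewrite acc (_ : g1 ^+ 2 - r * f2 = 0); first by ring.
  by lra.
by rewrite e1 e2 scale1r scale0r subrr subr0 scaler0.
Qed.

End MeridianMeanCurvature.

Theorem theorem3 (R : realType) (I J : set R) (f g : R -> R)
    (l : R -> 'rV[R]_4) (hM : meridian_surface2 I J f g l) :
  minimal_on (meridian_map f g l) I J <->
  is_spherical_curvature J l (fun=> 0) /\
  exists a b C : R, 0 < b - a ^+ 2 /\
    exists s1 s2 : bool, forall u, I u ->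
      f u = (-1) ^+ s1 * Num.sqrt (u ^+ 2 + 2 * a * u + b) /\
      g u = (-1) ^+ s2 * Num.sqrt (b - a ^+ 2)
              * ln `|u + a + Num.sqrt (u ^+ 2 + 2 * a * u + b)| + C.
Proof.
(* The pointwise criterion is a conjunction of a condition on [u] and one on [v]; a base point in
   each interval separates them. *)
have [[[u0 Iu0] _ _] [[v0 Jv0] _ _]] := (ms_I hM, ms_J hM).
rewrite -(profileP (ms_I hM) (ms_f_smooth hM) (ms_g_smooth hM)
  (ms_f_neq0 hM) (ms_arclength hM) (ms_dg_neq0 hM)).
rewrite (zero_spherical_curvatureP (ms_J hM) (ms_l_smooth hM)
  (fun v Jv => (ms_l_H21 hM Jv).1) (ms_l_unit hM)).
split=> [H|[ll ode] u v Iu Jv].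
  split=> [v Jv|u Iu].
    by have /(meridian_mean_curvature0P hM Iu0 Jv)[] := H _ _ Iu0 Jv.
  by have /(meridian_mean_curvature0P hM Iu Jv0)[] := H _ _ Iu Jv0.
by apply/(meridian_mean_curvature0P hM Iu Jv); rewrite ode// ll.
Qed.
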